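(* Let $G$ be a matching covered graph of perfect matching width $k$. Then there exists a PM-decomposition $(T,\delta)$ of $G$ such that the width of $(T,\delta)$ equals $k+(k\bmod 2)$ and $T$ has no odd edges.
   Context: All graphs are finite and simple. $\mathcal{M}(G)$ is the set of perfect matchings of $G$; $G$ is matching covered if connected and every edge lies in a perfect matching. For nonempty $X\subseteq V(G)$, $\partial(X)$ is the set of edges with exactly one endpoint in $X$, and $\operatorname{mp}(\partial(X))=\max_{M\in\mathcal{M}(G)}|M\cap\partial(X)|$. A PM-decomposition of $G$ is a pair $(T,\delta)$ with $T$ a cubic tree (all non-leaf vertices of degree 3) and $\delta$ a bijection from the leaves of $T$ to $V(G)$; each edge of $T$ splits the leaves into two sets whose $\delta$-images $X_1,X_2$ partition $V(G)$ and induces the cut $\partial(X_1)$; the width of $(T,\delta)$ is the maximum matching porosity of these cuts and the perfect matching width $\operatorname{pmw}(G)$ is the minimum width of a PM-decomposition. For a cubic tree $T$, the spine of $T$ is $T$ minus its leaves. An edge $e$ of the spine is even if both components of $T-e$ contain an even number of leaves of $T$, and odd otherwise; edges incident with leaves are not odd.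
   Formalization: The graph $G$ is assumed not to have exactly two vertices: for $K_2$ the perfect matching width is 1, but its only PM-decomposition has width 1, not $1+(1\bmod 2)=2$, so the claim fails there. *)

(* Defs.v *)
From mathcomp Require Import all_boot.

Set Implicit Arguments.
Unset Strict Implicit.
Unset Printing Implicit Defensive.

Record sgraph := SGraph {
  svertex :> finType;
  sedge : rel svertex;
  sedge_sym : symmetric sedge;
  sedge_irrefl : irreflexive sedge }.

Notation "x -- y" := (sedge x y) (at level 30).

Section Graphs.
Variable G : sgraph.

Definition edges : {set {set G}} :=
  [set e | [exists x : G, exists y : G, (x -- y) && (e == [set x; y])]].

Definition degree (x : G) : nat := #|[set y | x -- y]|.

Definition connected : Prop :=
  0 < #|G| /\ forall x y : G, connect (@sedge G) x y.

(* A cycle of a simple graph has length at least 3; [ucycle] also accepts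
   [:: x; y] for every edge x -- y. *)
Definition acyclic : Prop :=
  forall c : seq G, ucycle (@sedge G) c -> size c <= 2.

Definition is_tree : Prop := connected /\ acyclic.

Definition perfect_matching (M : {set {set G}}) : bool :=
  (M \subset edges) && [forall v : G, #|[set e in M | v \in e]| == 1].

Definition matching_covered : Prop :=
  connected /\
  forall e, e \in edges -> exists2 M, perfect_matching M & e \in M.

Definition cut (X : {set G}) : {set {set G}} :=
  [set e in edges | #|e :&: X| == 1].

Definition mp (C : {set {set G}}) : nat :=
  \max_(M : {set {set G}} | perfect_matching M) #|M :&: C|.

Definition leaf (t : G) : bool := degree t == 1.

Definition cubic_tree : Prop :=
  is_tree /\ forall t : G, ~~ leaf t -> degree t = 3.

Definition del_edge (t1 t2 : G) : rel G :=
  [rel x y | (x -- y) && ([set x; y] != [set t1; t2])].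

(* In a tree with t1 -- t2, the two components of T - t1t2 are
   [branch t1 t2] and [branch t2 t1]. *)
Definition branch (t1 t2 : G) : {set G} :=
  [set t | connect (del_edge t1 t2) t1 t].

Definition spine_edge (t1 t2 : G) : bool :=
  [&& t1 -- t2, ~~ leaf t1 & ~~ leaf t2].

Definition even_edge (t1 t2 : G) : bool :=
  ~~ odd #|[set t in branch t1 t2 | leaf t]| &&
  ~~ odd #|[set t in branch t2 t1 | leaf t]|.

Definition odd_edge (t1 t2 : G) : bool :=
  spine_edge t1 t2 && ~~ even_edge t1 t2.

End Graphs.

Record pm_decomposition (G : sgraph) := PMDecomposition {
  dtree : sgraph;
  dtree_cubic : cubic_tree dtree;
  delta : {t : dtree | leaf t} -> G;
  delta_bij : bijective delta }.

Section Width.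
Variable G : sgraph.

Definition shore (D : pm_decomposition G) (t1 t2 : dtree D) : {set G} :=
  [set delta l | l : {t : dtree D | leaf t} & val l \in branch t1 t2].

(* Each edge of the tree is visited in both orientations; they give
   complementary shores and hence the same cut. *)
Definition width (D : pm_decomposition G) : nat :=
  \max_(p : dtree D * dtree D | p.1 -- p.2) mp (cut (shore p.1 p.2)).

Definition has_pmw (k : nat) : Prop :=
  (exists D : pm_decomposition G, width D = k) /\
  forall D : pm_decomposition G, k <= width D.

End Width.

(* Main.v *)
Require Import Defs.
From mathcomp Require Import all_boot.

(* At every inner node of the tree of an optimal decomposition, zero or two of
   the three incident cuts are odd, so the odd tree edges form disjoint paths
   linking the leaves in pairs. Let a and b be the ends of such a path and
   Y_1, ..., Y_m the even shores hanging off it. Moving b next to a turns each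
   odd shore {a} + Y_1 + ... + Y_i along the path into the even shore
   {a, b} + Y_1 + ... + Y_i and raises its porosity by at most one. A perfect
   matching meets an odd cut in an odd number of edges, so the new porosity is
   at most k + (k mod 2). In the new decomposition all spine cuts are even,
   hence their porosities are even, and positive since G is matching covered.
   So its width, which is at least k, is even.

   The trees are handled as binary splittings of V - v0, rooted at the leaf of
   v0, and turned back into graphs through the laminar family of their parts. *)

Set Implicit Arguments.
Unset Strict Implicit.
Unset Printing Implicit Defensive.

(** * Leaving a set along a path, and unions of disjoint finite sets *)

Lemma connect_crossing (T : finType) (e : rel T) (A : {set T}) x y :
  connect e x y -> x \in A -> y \notin A ->
  exists a b, [/\ a \in A, b \notin A & e a b].
Proof.
case/connectP=> p; elim: p x => [|z p IH] x /=; first by move=> _ -> ->.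
case/andP=> xz pz ey xA yA; have [zA|zA] := boolP (z \in A).
  exact: IH pz ey zA yA.
by exists x, z.
Qed.

Lemma cardUd (T : finType) (A B : {set T}) :
  [disjoint A & B] -> #|A :|: B| = #|A| + #|B|.
Proof. by move=> dAB; rewrite cardsU (disjoint_setI0 dAB) cards0 subn0. Qed.

Lemma disjointsU1 (T : finType) (A B : {set T}) x :
  [disjoint x |: A & B] = (x \notin B) && [disjoint A & B].
Proof. by rewrite -disjointU1; apply: eq_disjoint => z; rewrite !inE. Qed.

Lemma disjoint_notin (T : finType) (A B : {set T}) x :
  [disjoint A & B] -> x \in A -> x \notin B.
Proof. by move=> d xA; rewrite (disjointFr d xA). Qed.

(** * Parity and porosity of cuts in a graph *)

Section MatchingCuts.
Variable G : sgraph.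
Implicit Types (A B : {set G}) (M : {set {set G}}) (a b v x y : G).

Lemma edgesP (e : {set G}) :
  reflect (exists x y, x -- y /\ e = [set x; y]) (e \in edges G).
Proof.
rewrite inE; apply: (iffP existsP) => [[x /existsP[y /andP[xy /eqP->]]]|].
  by exists x, y.
by case=> x [y [xy ->]]; exists x; apply/existsP; exists y; rewrite xy eqxx.
Qed.

Lemma edge_neq x y : x -- y -> x != y.
Proof. by move=> xy; apply/eqP=> exy; rewrite exy sedge_irrefl in xy. Qed.

Lemma card_edge (e : {set G}) : e \in edges G -> #|e| = 2.
Proof. by case/edgesP=> x [y [xy ->]]; rewrite cards2 edge_neq. Qed.

(** Each vertex of [A] lies on exactly one edge of [M], so [#|A|] is the sum of [#|e :&: A|] over
    [e] in [M]. The summands are 0, 1 or 2, and they are odd exactly on the cut. *)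
Lemma odd_card_matching_cut M A :
  perfect_matching M -> odd #|M :&: cut A| = odd #|A|.
Proof.
case/andP=> /subsetP sME /forallP cM.
have -> : #|A| = \sum_(e in M) #|e :&: A|.
  rewrite -sum1_card.
  under [RHS]eq_bigr do rewrite -sum1_card.
  rewrite [RHS](exchange_big_dep (mem A)) /=; last first.
    by move=> e v _ /setIP[].
  apply: eq_bigr => v vA; rewrite sum1_card -(eqP (cM v)).
  by apply: eq_card => e; rewrite inE [RHS]unfold_in /= in_setI vA andbT.
have -> : #|M :&: cut A| = \sum_(e in M) (e \in cut A).
  rewrite -sum1_card big_mkcond [RHS]big_mkcond; apply: eq_bigr => e _.
  by rewrite in_setI; case: (e \in M) => //; case: (e \in cut A).
rewrite !(big_morph odd oddD (erefl _)); apply: eq_bigr => e /sME eE.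
have: #|e :&: A| <= 2 by rewrite -(card_edge eE) subset_leq_card ?subsetIl.
by rewrite [e \in _]inE eE; case: #|_| => [|[|[]]].
Qed.

Lemma matching_cut_le_mp M A :
  perfect_matching M -> #|M :&: cut A| <= mp (cut A).
Proof. by move=> pM; apply: (bigmax_sup M). Qed.

(** Only the matching edge that covers [v] can enter the cut when [v] is added. *)
Lemma matching_cutU1 M A v :
  perfect_matching M -> #|M :&: cut (v |: A)| <= #|M :&: cut A|.+1.
Proof.
case/andP=> _ /forallP/(_ v)/eqP cv.
rewrite -addn1 -{}cv; apply: leq_trans (leq_card_setU _ _).
apply/subset_leq_card/subsetP=> e; rewrite !inE => /and3P[-> -> /=].
have [|ve] := boolP (v \in e); first by rewrite orbT.
suff -> : e :&: (v |: A) = e :&: A by move->.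
apply/setP=> x; rewrite !inE; case: eqVneq => // ->; by rewrite (negPf ve).
Qed.

Lemma cutC A : cut (~: A) = cut A.
Proof.
apply/setP=> e; rewrite !inE; apply: andb_id2l => eE.
have := cardsID A e.
have -> : #|e| = 2 by apply: card_edge; rewrite inE.
by rewrite -setDE; case: #|e :&: A| => [|[|[|?]]] //; case: #|_| => [|[|[|?]]].
Qed.

Lemma cut0 : cut set0 = set0 :> {set {set G}}.
Proof. by apply/setP=> e; rewrite !inE setI0 cards0 andbF. Qed.

Lemma mp_cut_le A n :
  (forall M, perfect_matching M -> #|M :&: cut A| <= n) -> mp (cut A) <= n.
Proof. by move=> h; apply/bigmax_leqP=> M /h. Qed.

Lemma matching_cut1 M v : perfect_matching M -> #|M :&: cut [set v]| <= 1.
Proof.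
move=> pM; have := matching_cutU1 set0 v pM.
by rewrite setU0 cut0 setI0 cards0.
Qed.

Lemma mp_cut1 v : mp (cut [set v]) <= 1.
Proof. by apply: mp_cut_le => M; exact: matching_cut1. Qed.

Lemma mp_cut2 a b : mp (cut [set a; b]) <= 2.
Proof.
apply: mp_cut_le => M pM; apply: leq_trans (matching_cutU1 _ _ pM) _.
by rewrite ltnS matching_cut1.
Qed.

(** Connectedness yields an edge that crosses the cut, and some perfect matching contains it. *)
Lemma mp_cut_gt0 A :
  matching_covered G -> A != set0 -> A != setT -> 0 < mp (cut A).
Proof.
case=> [[_ cG] mG] /set0Pn[x xA]; rewrite -subTset => /subsetPn[y _ yA].
have [a [b [aA bA ab]]] := connect_crossing (cG x y) xA yA.
have abE : [set a; b] \in edges G by apply/edgesP; exists a, b.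
have [M pM abM] := mG _ abE.
apply: leq_trans (matching_cut_le_mp A pM); apply/card_gt0P.
exists [set a; b]; rewrite in_setI abM inE abE /=.
suff -> : [set a; b] :&: A = [set a] by rewrite cards1.
apply/setP=> z; rewrite !inE; case: eqVneq => [->|_] //=.
by case: eqVneq => // ->; rewrite (negPf bA).
Qed.

(** Without perfect matchings the maximum in [mp] would range over nothing and be 0, but the cut
    around a single vertex has positive porosity. *)
Lemma exists_perfect_matching :
  matching_covered G -> 1 < #|G| -> exists M : {set {set G}}, perfect_matching M.
Proof.
move=> mG nG; have /card_gt0P[v _] : 0 < #|G| by apply: ltnW.
have : 0 < mp (cut [set v]).
  apply: mp_cut_gt0 => //; first by apply/set0Pn; exists v; rewrite inE.
  by apply: contraTneq nG => eT; rewrite -cardsT -eT cards1.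
rewrite /mp; have [M pM|noM] := pickP (@perfect_matching G); first by exists M.
by rewrite big_pred0.
Qed.

Lemma even_order (M : {set {set G}}) : perfect_matching M -> ~~ odd #|G|.
Proof.
move=> pM; rewrite -cardsT -(odd_card_matching_cut setT pM) -setC0 cutC cut0.
by rewrite setI0 cards0.
Qed.

(* Every perfect matching meets an odd cut in an odd number of edges. *)
Lemma mp_cut_move A B v k :
  odd #|A| -> mp (cut A) <= k -> v |: A = B \/ v |: B = A ->
  mp (cut B) <= k + k %% 2.
Proof.
move=> oA mA hB; apply: mp_cut_le => M pM.
have oM := odd_card_matching_cut A pM; rewrite oA in oM.
have lek := leq_trans (matching_cut_le_mp A pM) mA.
suff leB : #|M :&: cut B| <= #|M :&: cut A|.+1.
  (* For odd [k] the summand [k %% 2] absorbs the extra edge. For even [k] the odd number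
     [#|M :&: cut A|] differs from [k], so it is smaller and leaves room for one more. *)
  rewrite modn2; case ok: (odd k); first by rewrite addn1 (leq_trans leB).
  rewrite addn0; apply: leq_trans leB _.
  by rewrite ltn_neqAle lek andbT; apply: contraFneq ok => <-.
case: hB => [<-|hB]; first exact: matching_cutU1.
have [vB|vB] := boolP (v \in B).
  by rewrite -hB (setUidPr _) // sub1set.
(* Deleting [v] from a set adds it to the complement, which has the same cut. *)
suff hC : ~: B = v |: ~: A by rewrite -cutC hC -(cutC A) matching_cutU1.
rewrite -hB; apply/setP=> x; rewrite !inE negb_or.
by case: eqVneq => // ->; rewrite (negPf vB).
Qed.

End MatchingCuts.

(** * Binary splittings of a finite set *)

Section Hierarchy.
Variable T : finType.
Implicit Types (A B X Y : {set T}) (P : {set T} -> Prop).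

(** A derivation is a rooted binary tree whose leaves are the elements of the set. Its nodes are the
    shores of a cubic tree on the side away from a root leaf. *)
Inductive hierarchy P : {set T} -> Prop :=
| hierarchy1 v : P [set v] -> hierarchy P [set v]
| hierarchyU A B : hierarchy P A -> hierarchy P B -> [disjoint A & B] ->
    P (A :|: B) -> hierarchy P (A :|: B).

Lemma hierarchy_top P X : hierarchy P X -> P X.
Proof. by case. Qed.

Lemma hierarchy_neq0 P X : hierarchy P X -> X != set0.
Proof.
elim=> [v _|A B _ /set0Pn[x xA] _ _ _ _]; apply/set0Pn.
  by exists v; rewrite inE.
by exists x; rewrite inE xA.
Qed.

End Hierarchy.

(** The second clause confines odd shores to tree edges at a leaf: one of the two sides is a single
    vertex. *)
Definition tame_shore (G : sgraph) (k : nat) (X : {set G}) : Prop :=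
  mp (cut X) <= k + k %% 2 /\ (odd #|X| -> #|X| = 1 \/ #|~: X| = 1).

(** * Moving leaves along paths of odd cuts *)

Section Rearrange.
Variables (G : sgraph) (k : nat).
Hypothesis k_gt0 : 0 < k.
Implicit Types (A B X Y : {set G}).

Let P X := mp (cut X) <= k.
Let Q := @tame_shore G k.

(* A path of odd cuts starting at the leaf [v], with the even parts hanging
   off it. *)
Inductive odd_chain (v : G) : {set G} -> Prop :=
| odd_chain1 : odd_chain v [set v]
| odd_chainU A Y : odd_chain v A -> hierarchy Q Y -> ~~ odd #|Y| ->
    [disjoint A & Y] -> P (A :|: Y) -> odd_chain v (A :|: Y).

Lemma P_even_Q X : P X -> ~~ odd #|X| -> Q X.
Proof.
by move=> PX oX; split; [apply: leq_trans PX (leq_addr _ _)|rewrite (negPf oX)].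
Qed.

Lemma odd_chain_mem v A : odd_chain v A -> v \in A.
Proof. by elim=> [|B Y _ vB *]; rewrite inE ?vB. Qed.

Lemma odd_chain_odd v A : odd_chain v A -> odd #|A|.
Proof.
elim=> [|B Y _ oB _ oY dBY _]; first by rewrite cards1.
by rewrite cardUd // oddD oB (negPf oY).
Qed.

Lemma hierarchyQ1 v : hierarchy Q [set v].
Proof.
apply: hierarchy1; split=> [|_]; last by left; rewrite cards1.
by rewrite (leq_trans (mp_cut1 v)) // (leq_trans k_gt0) ?leq_addr.
Qed.

(** The leaf [b] is inserted right beside [v], so each odd set of the chain gains one vertex and
    becomes even, while the even parts stay attached in the same order. *)
Lemma odd_chain_add v A b : odd_chain v A -> b \notin A -> hierarchy Q (b |: A).
Proof.
elim=> [|B Y cB IH hY oY dBY PBY] bA.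
  apply: hierarchyU; try exact: hierarchyQ1; first by rewrite disjoints1.
  split; last by rewrite cards2; move: bA; rewrite inE => ->.
  (* As [k] is positive, [k + k %% 2] is at least 2, the bound for a pair. *)
  apply: leq_trans (mp_cut2 _ _) _; rewrite modn2.
  by case: (k) k_gt0 => [|[|?]] // _; rewrite ltn_addr.
move: (bA); rewrite inE negb_or => /andP[bB bY].
rewrite setUA; apply: hierarchyU => //; first exact: IH.
  by rewrite disjointsU1 bY.
rewrite -setUA; have oBY : odd #|B :|: Y|.
  by rewrite cardUd // oddD (odd_chain_odd cB) (negPf oY).
split; first by apply: (mp_cut_move (v := b) oBY PBY); left.
by rewrite cardsU1 bA add1n /= oBY.
Qed.

(** Without [v] every odd set of the chain becomes even. A chain that is just [v] is set apart
    because the empty set has no hierarchy. *)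
Lemma odd_chain_del v A :
  odd_chain v A -> A = [set v] \/ hierarchy Q (A :\ v).
Proof.
elim=> [|B Y cB IH hY oY dBY PBY]; first by left.
have vB := odd_chain_mem cB; have vY := disjoint_notin dBY vB.
right; have eD : (B :|: Y) :\ v = (B :\ v) :|: Y.
  rewrite setDUl; congr (_ :|: _); apply/setDidPl.
  by rewrite disjoint_sym disjoints1.
case: IH => [eB|hB].
  by rewrite eD eB setDv set0U.
have dD : [disjoint B :\ v & Y] by apply: disjointWl dBY; apply: subsetDl.
have oBY : odd #|B :|: Y|.
  by rewrite cardUd // oddD (odd_chain_odd cB) (negPf oY).
have vBY : v \in B :|: Y by rewrite inE vB.
rewrite eD; apply: hierarchyU => //; rewrite -eD; split.
  by apply: (mp_cut_move (v := v) oBY PBY); right; apply: setD1K.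
by move: oBY; rewrite (cardsD1 v) vBY /= => /negPf->.
Qed.

(** An odd set carries an unfinished path of odd cuts, to be closed higher up; an even set has all
    its paths closed already. *)
Lemma rearrange X : hierarchy P X ->
  if odd #|X| then exists v, odd_chain v X else hierarchy Q X.
Proof.
elim=> [v _|A B hA IA hB IB dAB PAB].
  by rewrite cards1; exists v; constructor.
rewrite cardUd // oddD; case oA: (odd #|A|) IA; case oB: (odd #|B|) IB => /=.
- move=> [b cB] [a cA]; have bB := odd_chain_mem cB.
  have bA : b \notin A by apply: disjoint_notin bB; rewrite disjoint_sym.
  case: (odd_chain_del cB) => [->|hBb].
    by rewrite setUC; apply: odd_chain_add cA bA.
  (* The paths from [a] and [b] meet at this node. Moving [b] next to [a] makes both parts even and
     leaves their union, hence its cut, unchanged. *)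
  have -> : A :|: B = (b |: A) :|: (B :\ b).
    by rewrite -{1}(setD1K bB) setUCA setUA.
  apply: hierarchyU => //; first exact: odd_chain_add cA bA.
    rewrite disjointsU1 !inE eqxx /=; apply: disjointWr dAB; exact: subsetDl.
  rewrite -setUA setUCA (setD1K bB); apply: P_even_Q => //.
  by rewrite cardUd // oddD oA oB.
- move=> hQB [a cA]; exists a; apply: odd_chainU => //; by rewrite oB.
- move=> [b cB] hQA; exists b; rewrite setUC; apply: odd_chainU => //.
  + by rewrite oA.
  + by rewrite disjoint_sym.
  + by rewrite setUC.
- move=> hQB hQA; apply: hierarchyU => //; apply: P_even_Q => //.
  by rewrite cardUd // oddD oA oB.
Qed.

(** The last path runs from some leaf [v] up to the root leaf [v0]. Splitting off [v] at the top
    places it next to [v0] and makes the sets below on that path even. *)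
Lemma rearrange_coatom v0 : ~~ odd #|G| ->
  hierarchy P (~: [set v0]) -> hierarchy Q (~: [set v0]).
Proof.
move=> eG /rearrange.
have oX : odd #|~: [set v0]|.
  by move: eG; rewrite -(cardsC [set v0]) cards1 negbK.
rewrite oX => -[v cX]; case: (odd_chain_del cX) => [->|hX].
  exact: hierarchyQ1.
rewrite -(setD1K (odd_chain_mem cX)); apply: hierarchyU => //.
- exact: hierarchyQ1.
- by rewrite disjoints1 !inE eqxx.
rewrite (setD1K (odd_chain_mem cX)); split; last by right; rewrite setCK cards1.
by rewrite cutC (leq_trans (mp_cut1 v0)) // (leq_trans k_gt0) ?leq_addr.
Qed.

End Rearrange.

(** * Branches of trees *)

Section Trees.
Variable T : sgraph.
Implicit Types (a b c d t u w x y z : T).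

Lemma del_edgeE x y u w :
  del_edge x y u w = (u -- w) && ([set u; w] != [set x; y]).
Proof. by []. Qed.

Lemma del_edgeC x y : del_edge x y =2 del_edge y x.
Proof. by move=> u w; rewrite !del_edgeE (setUC [set y]). Qed.

Lemma del_edge_sym x y : symmetric (del_edge x y).
Proof. by move=> u w; rewrite !del_edgeE sedge_sym (setUC [set w]). Qed.

Lemma connect_del_edge_sym x y : connect_sym (del_edge x y).
Proof. exact/sym_connect_sym/del_edge_sym. Qed.

Lemma branch_root x y : x \in branch x y.
Proof. by rewrite inE connect0. Qed.

Lemma branch_ext x y u w :
  u \in branch x y -> del_edge x y u w -> w \in branch x y.
Proof. by rewrite !inE => xu uw; apply: connect_trans xu (connect1 uw). Qed.

Lemma branchC_mem x y z : (z \in branch y x) = connect (del_edge x y) y z.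
Proof. by rewrite inE; apply: eq_connect; apply: del_edgeC. Qed.

Lemma eq_set2 u w x y : [set u; w] = [set x; y] -> u != w ->
  u = x /\ w = y \/ u = y /\ w = x.
Proof.
move=> e uw; have := set21 u w; have := set22 u w; rewrite e !inE.
by case/orP=> /eqP ew /orP[] /eqP eu; subst; rewrite ?eqxx in uw *; auto.
Qed.

Hypothesis acT : acyclic T.

(** A simple path from [x] to [y] that avoids the edge [x -- y] has at least two edges, so that edge
    closes it to a cycle on at least three vertices. *)
Lemma acyclic_bridge x y : x -- y -> y \notin branch x y.
Proof.
move=> xy; rewrite inE; apply/negP=> /connectP[p px ey].
case/shortenP: px ey => {p} [[|z [|w p]]] pp up _ /= ey.
- by rewrite ey sedge_irrefl in xy.
- by move: pp; rewrite /= del_edgeE -ey eqxx andbF.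
suff : ucycle (@sedge T) (x :: z :: w :: p) by move/acT.
rewrite /ucycle up andbT /= !andbA.
have pT : path (@sedge T) x [:: z, w & p].
  by apply: sub_path pp => a b /andP[].
by rewrite rcons_path -andbA; move: pT => /= /and3P[-> -> ->]; rewrite -ey sedge_sym.
Qed.

(** Adjacency after deleting the vertex [t]. Unlike [del_edge c t] it does not depend on [c], so the
    branches at different neighbours of [t] become components of one relation. *)
Definition avoiding t : rel T := [rel u w | [&& u -- w, u != t & w != t]].

Lemma avoiding_sym t : symmetric (avoiding t).
Proof. by move=> u w; rewrite /avoiding /= sedge_sym (andbC (u != t)). Qed.

Lemma avoiding_del_edge t c u w : avoiding t u w -> del_edge c t u w.
Proof.
rewrite del_edgeE; case/and3P=> -> ut wt; apply: contraNneq ut => e.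
by have := set22 c t; rewrite -e !inE (eq_sym t w) (negPf wt) orbF eq_sym.
Qed.

Lemma connect_avoiding t c x z :
  connect (avoiding t) x z -> connect (del_edge c t) x z.
Proof.
by apply: connect_sub => u w uw; apply/connect1/avoiding_del_edge.
Qed.

(** The branch never reaches [t], because [c -- t] is a bridge; so deleting the vertex or the edge
    gives the same component. *)
Lemma mem_branch_avoiding t c z :
  c -- t -> (z \in branch c t) = connect (avoiding t) c z.
Proof.
move=> ct; apply/idP/idP; last by rewrite inE; apply: connect_avoiding.
pose S := [set w | connect (avoiding t) c w].
have sS u : u \in S -> u \in branch c t.
  by rewrite !inE; apply: connect_avoiding.
rewrite inE => cz; suff : z \in S by rewrite inE.
apply: contraT => zS.
have [|u [w [uS wS uw]]] := connect_crossing cz _ zS; first by rewrite inE.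
have uB := sS _ uS; have wB := branch_ext uB uw.
have nt x : x \in branch c t -> x != t.
  by apply: contraTneq => ->; apply: acyclic_bridge.
case/negP: wS; move: uS; rewrite !inE => cu; apply: connect_trans cu _.
apply: connect1; rewrite /avoiding /= (nt _ wB) (nt _ uB) !andbT.
by case/andP: uw.
Qed.

Lemma branch_step t1 t2 z : t1 -- t2 ->
  reflect (z = t1 \/ exists c, [/\ c != t2, t1 -- c & z \in branch c t1])
          (z \in branch t1 t2).
Proof.
move=> t12; apply: (iffP idP); last first.
  case=> [->|[c [ct2 t1c]]]; first exact: branch_root.
  rewrite mem_branch_avoiding 1?sedge_sym // => /(connect_avoiding t2).
  rewrite (eq_connect (del_edgeC _ _)); rewrite [z \in _]inE.
  apply: connect_trans; apply: connect1; rewrite del_edgeE t1c.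
  apply: contra_neq ct2 => e; have [[_ ->]//|[e2 _]] := eq_set2 e (edge_neq t1c).
  by rewrite e2 sedge_irrefl in t12.
(* The right-hand side as a set. It contains [t1], so it remains to see that no edge other than
   [t1 -- t2] leaves it. *)
pose S := [set w | (w == t1) ||
  [exists c, [&& c != t2, t1 -- c & w \in branch c t1]]].
have SP w : reflect
    (w = t1 \/ exists c, [/\ c != t2, t1 -- c & w \in branch c t1]) (w \in S).
  rewrite inE; apply: (iffP orP) => -[h|h].
  - by left; apply/eqP.
  - by right; have /existsP[c /and3P[]] := h; exists c.
  - by left; rewrite h.
  - by right; case: h => c [h1 h2 h3]; apply/existsP; exists c; apply/and3P.
rewrite inE => cz; apply/SP; apply: contraT => zS.
have [|u [w [uS wS uw]]] := connect_crossing cz _ zS; first by apply/SP; left.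
case/negP: wS; apply/SP; case/SP: uS => [eu|[c [ct2 t1c uc]]].
  right; exists w; rewrite branch_root; move: uw; rewrite eu del_edgeE => /andP[-> e].
  by split=> //; apply: contraNneq e => ->.
(* The branch of [c] can be left only through the edge between [c] and [t1], and both of its ends
   belong to [S]. *)
have [e|e] := eqVneq [set u; w] [set c; t1].
  have : w \in [set c; t1] by rewrite -e set22.
  by rewrite !inE => /orP[] /eqP->; [right; exists c; rewrite branch_root|left].
right; exists c; split=> //; apply: branch_ext uc _.
by rewrite del_edgeE e andbT; case/andP: uw.
Qed.

Lemma branch_disjoint t c d :
  c -- t -> d -- t -> c != d -> [disjoint branch c t & branch d t].
Proof.
move=> ct dt cd; rewrite -setI_eq0; apply: contraT => /set0Pn[z /setIP[]].
rewrite !mem_branch_avoiding // => cz dz.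
have dc : c \in branch d t.
  rewrite mem_branch_avoiding //; apply: connect_trans dz _.
  by rewrite (sym_connect_sym (@avoiding_sym t)).
case/negP: (acyclic_bridge dt); apply: branch_ext dc _; rewrite del_edgeE ct.
apply: contra_neq cd => e; case: (eq_set2 e (edge_neq ct)) => [[]//|[ec et]].
by rewrite ec -et.
Qed.

(** The bridge property makes the two branches disjoint; connectedness makes them cover the tree,
    since only the deleted edge can leave either of them. *)
Lemma branchC t1 t2 : connected T -> t1 -- t2 -> branch t2 t1 = ~: branch t1 t2.
Proof.
move=> [_ cT] t12; apply/eqP; rewrite eqEsubset; apply/andP; split.
  apply/subsetP=> z; rewrite branchC_mem in_setC => t2z.
  apply: contra (acyclic_bridge t12); rewrite !inE => t1z.
  by apply: connect_trans t1z _; rewrite connect_del_edge_sym.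
apply/subsetP=> z; rewrite in_setC => zB1; apply: contraT => zB2.
have zU : z \notin branch t1 t2 :|: branch t2 t1 by rewrite inE negb_or zB1.
have [|u [w [uU wU uw]]] := connect_crossing (cT t1 z) _ zU.
  by rewrite inE branch_root.
case/negP: wU; have [e|e] := eqVneq [set u; w] [set t1; t2].
  have : w \in [set t1; t2] by rewrite -e set22.
  by case/set2P=> ->; rewrite inE branch_root ?orbT.
have duw : del_edge t1 t2 u w by rewrite del_edgeE uw.
case/setUP: uU => [/branch_ext/(_ duw)|]; first by rewrite in_setU => ->.
by rewrite del_edgeC in duw; move/branch_ext/(_ duw); rewrite in_setU orbC => ->.
Qed.

End Trees.

(** * From a PM-decomposition to a hierarchy *)

Section Shores.
Variables (G : sgraph) (D : pm_decomposition G).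
Implicit Types (t : dtree D) (l : {t : dtree D | leaf t}).

Lemma delta_surj v : exists l, delta l = v.
Proof. by have [g _ gK] := delta_bij D; exists (g v). Qed.

Lemma mem_shore t1 t2 l : (delta l \in shore t1 t2) = (val l \in branch t1 t2).
Proof.
apply/imsetP/idP=> [[l']|lB]; last by exists l; rewrite // in_set.
by rewrite in_set => l'B /(bij_inj (delta_bij D)) ->.
Qed.

Lemma card_shore t1 t2 : #|shore t1 t2| = #|[set t in branch t1 t2 | leaf t]|.
Proof.
rewrite card_imset; last exact: bij_inj (delta_bij D).
rewrite -(card_imset _ val_inj); apply: eq_card => t; rewrite !inE.
apply/imsetP/andP=> [[l]|[tB lt]].
  by rewrite inE => lB ->; split; [rewrite inE in lB|apply: valP].
by exists (Sub t lt) => //; rewrite inE SubK inE.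
Qed.

Lemma shoreC t1 t2 : t1 -- t2 -> shore t2 t1 = ~: shore t1 t2.
Proof.
have [[cT aT] _] := dtree_cubic D; move=> t12; apply/setP=> v.
have [l <-] := delta_surj v.
by rewrite in_setC !mem_shore (branchC aT cT t12) in_setC.
Qed.

Lemma leaf_has_neighbour l : exists t, val l -- t.
Proof.
by have /cards1P[t Nt] := valP l; exists t; have := set11 t; rewrite -Nt inE.
Qed.

Lemma leaf_neighbour t1 t2 c : leaf t1 -> t1 -- t2 -> t1 -- c -> c = t2.
Proof.
move=> /cards1P[x Nx] t12 t1c.
have : t2 \in [set x] by rewrite -Nx inE.
have : c \in [set x] by rewrite -Nx inE.
by rewrite !inE => /eqP -> /eqP ->.
Qed.

Lemma shore_leaf l t2 : val l -- t2 -> shore (val l) t2 = [set delta l].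
Proof.
have [[_ aT] _] := dtree_cubic D; move=> lt2; apply/setP=> v.
have [l' <-] := delta_surj v.
rewrite mem_shore inE (bij_eq (delta_bij D)) -val_eqE.
apply/(branch_step aT _ lt2)/eqP=> [[//|[c [ct2 lc _]]]|]; last by left.
by rewrite (leaf_neighbour (valP l) lt2 lc) eqxx in ct2.
Qed.

(** [a] and [b] are the two neighbours of [t1] other than [t2]. The strict bounds on branches serve
    as the measure for induction on the tree. *)
Lemma shore_split t1 t2 : t1 -- t2 -> ~~ leaf t1 ->
  exists a b, [/\ [/\ a -- t1, b -- t1 & shore t1 t2 = shore a t1 :|: shore b t1],
    [disjoint shore a t1 & shore b t1],
    #|branch a t1| < #|branch t1 t2| & #|branch b t1| < #|branch t1 t2|].
Proof.
have [[cT aT] dT] := dtree_cubic D; move=> t12 /dT d3.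
have /cards2P[a [b [ab Nab]]] : #|[set c | t1 -- c] :\ t2| == 2.
  by move: d3; rewrite /degree (cardsD1 t2) inE t12 add1n => -[->].
have N c : (c != t2) && (t1 -- c) = (c == a) || (c == b).
  by have := congr1 (fun S : {set _} => c \in S) Nab; rewrite !inE.
have /andP[at2 t1a] : (a != t2) && (t1 -- a) by rewrite N eqxx.
have /andP[bt2 t1b] : (b != t2) && (t1 -- b) by rewrite N eqxx orbT.
have ltB c : c != t2 -> t1 -- c -> #|branch c t1| < #|branch t1 t2|.
  move=> ct2 t1c; apply/proper_card/properP; split; last first.
    by exists t1; [apply: branch_root|apply: acyclic_bridge; rewrite // sedge_sym].
  by apply/subsetP=> z zc; apply/(branch_step aT _ t12); right; exists c.
exists a, b; split; rewrite ?ltB //; first split; try by rewrite sedge_sym.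
  apply/setP=> v; have [l <-] := delta_surj v; rewrite inE !mem_shore.
  apply/(branch_step aT _ t12)/orP=> [[el|[c [ct2 t1c lc]]]|].
  - by have := valP l; rewrite el /leaf d3.
  - by have := N c; rewrite ct2 t1c => /esym/orP[] /eqP<-; auto.
  - by case=> ?; right; [exists a|exists b].
rewrite disjoint_subset; apply/subsetP=> v; have [l <-] := delta_surj v.
rewrite inE !mem_shore; apply: disjoint_notin; apply: branch_disjoint => //.
- by rewrite sedge_sym.
- by rewrite sedge_sym.
Qed.

Lemma shore_leafl t1 t2 :
  leaf t1 -> t1 -- t2 -> exists v, shore t1 t2 = [set v].
Proof.
move=> lt; rewrite -[t1]/(val (Sub t1 lt : {t : dtree D | leaf t})) => t12.
by rewrite shore_leaf //; exists (delta (Sub t1 lt)).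
Qed.

Lemma shore_hierarchy (P : {set G} -> Prop) :
  (forall t1 t2, t1 -- t2 -> P (shore t1 t2)) ->
  forall t1 t2, t1 -- t2 -> hierarchy P (shore t1 t2).
Proof.
move=> PD t1 t2.
have [n] := ubnP #|branch t1 t2|; elim: n t1 t2 => // n IH t1 t2 Bn t12.
have PS := PD _ _ t12; have [lt|] := boolP (leaf t1).
  by have [v eS] := shore_leafl lt t12; rewrite eS in PS *; apply: hierarchy1.
case/(shore_split t12)=> a [b [[t1a t1b eS] dS lta ltb]].
rewrite eS in PS *; apply: hierarchyU => //.
- by apply: IH => //; apply: leq_trans lta Bn.
- by apply: IH => //; apply: leq_trans ltb Bn.
Qed.

Lemma shore_neq0 t1 t2 : t1 -- t2 -> shore t1 t2 != set0.
Proof.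
(* The trivial property is enough here: every set with a hierarchy is nonempty. *)
move=> t12; have h := @shore_hierarchy (fun=> True) (fun _ _ _ => I) _ _ t12.
exact: hierarchy_neq0 h.
Qed.

Lemma leaf_shore1 t1 t2 : t1 -- t2 -> #|shore t1 t2| = 1 -> leaf t1.
Proof.
move=> t12 S1; apply: contraT; case/(shore_split t12)=> a [b [[t1a t1b eS] dS _ _]].
have := shore_neq0 t1a; have := shore_neq0 t1b.
move: S1; rewrite eS cardUd // -!card_gt0.
by case: #|_| => // -[|?] //; rewrite ?addn0; case: #|_|.
Qed.

Lemma mp_shore_le_width t1 t2 : t1 -- t2 -> mp (cut (shore t1 t2)) <= width D.
Proof. by move=> t12; apply: (bigmax_sup (t1, t2)). Qed.

(** The tree is rooted at the leaf of [v]: seen from the neighbour of that leaf, the shore is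
    everything except [v]. *)
Lemma decomposition_hierarchy (v : G) :
  hierarchy (fun X : {set G} => mp (cut X) <= width D) (~: [set v]).
Proof.
have [l <-] := delta_surj v.
have [t lt] := leaf_has_neighbour l.
rewrite -(shore_leaf lt) -shoreC //; apply: shore_hierarchy => [t1 t2|].
  exact: mp_shore_le_width.
by rewrite sedge_sym.
Qed.

End Shores.

(** * Trees given by a parent function that decreases a depth *)

Section ParentGraph.
Variables (T : finType) (p : T -> T) (r : T) (depth : T -> nat).
Hypothesis depth_parent : forall x, x != r -> depth (p x) < depth x.
Implicit Types (x y : T) (S : {set T}).

Definition parent_edge : rel T :=
  [rel x y | (x != r) && (p x == y) || (y != r) && (p y == x)].

Lemma parent_edge_sym : symmetric parent_edge.
Proof. by move=> x y; rewrite /parent_edge /= orbC. Qed.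

Lemma parent_edge_irrefl : irreflexive parent_edge.
Proof.
move=> x; rewrite /parent_edge /= orbb; case: eqVneq => //= xr; apply/negP=> /eqP e.
by have := depth_parent xr; rewrite e ltnn.
Qed.

Definition parent_graph := SGraph parent_edge_sym parent_edge_irrefl.

Lemma parent_edgeP x y :
  reflect (x != r /\ p x = y \/ y != r /\ p y = x) (parent_edge x y).
Proof.
apply: (iffP orP) => -[]; try by case/andP=> ? /eqP; auto.
- by case=> h <-; left; rewrite h eqxx.
- by case=> h <-; right; rewrite h eqxx.
Qed.

Lemma parent_graph_connected : connected parent_graph.
Proof.
have cr x : connect parent_edge x r.
  have [n] := ubnP (depth x); elim: n x => // n IH x dx.
  have [-> //|xr] := eqVneq x r.
  apply: connect_trans (IH (p x) _); last exact: leq_trans (depth_parent xr) dx.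
  by apply: connect1; apply/parent_edgeP; left.
split; first by apply/card_gt0P; exists r.
move=> x y; apply: connect_trans (cr x) _.
by rewrite (sym_connect_sym parent_edge_sym); apply: cr.
Qed.

(* Both cycle neighbours of a deepest vertex of a cycle would be its parent. *)
Lemma parent_graph_acyclic : acyclic parent_graph.
Proof.
move=> c /andP[cc uc]; rewrite leqNgt; apply/negP=> sc.
case: c sc cc uc => // x0 c0; move: (mem_head x0 c0).
set c := x0 :: c0 => x0c sc cc uc.
have [x xc mx] := @arg_maxnP _ x0 (mem c) depth x0c.
have [i s es] := rot_to xc.
move: (cc) (uc) (sc); rewrite -(rot_cycle i) -(rot_uniq i) -(size_rot i c) es.
have up y : y \in c -> parent_edge x y -> y = p x.
  move=> yc /parent_edgeP[[_ <-]//|[yr e]].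
  by have := leq_trans (depth_parent yr) (mx _ yc); rewrite e ltnn.
case: s es => [|y [|z s]] // es /=.
rewrite rcons_path => /and4P[xy _ _ lx] /andP[_ /andP[yzs _]] _.
have rc w : w \in [:: x, y, z & s] -> w \in c by rewrite -es mem_rot.
have ey : y = p x by apply: up => //; apply: rc; rewrite !inE eqxx orbT.
have el : last z s = p x.
  apply: up; last by rewrite parent_edge_sym.
  by apply: rc; rewrite 2!in_cons mem_last !orbT.
by case/negP: yzs; rewrite ey -el mem_last.
Qed.

(** The hypotheses say that the edge from [x] to its parent is the only one leaving [S]. Conversely,
    passing to parents inside [S] must end at [x], because the root lies outside. *)
Lemma parent_graph_branch x S :
  x != r -> x \in S -> r \notin S -> p x \notin S ->
  (forall y, y != r -> y != x -> (p y \in S) = (y \in S)) ->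
  @branch parent_graph x (p x) = S.
Proof.
move=> xr xS rS pxS clS; apply/eqP; rewrite eqEsubset; apply/andP; split.
  apply/subsetP=> y; rewrite inE => xy; apply: contraT => yS.
  have [u [w [uS wS /andP[/parent_edgeP uw nuw]]]] := connect_crossing xy xS yS.
  case: uw => [[ur ew]|[wr eu]].
    have [eux|ux] := eqVneq u x.
      by case/eqP: nuw; rewrite -ew eux.
    by rewrite -ew clS ?uS in wS.
  have wx : w != x by apply: contraNneq wS => ->.
  by rewrite -eu clS ?(negPf wS) in uS.
apply/subsetP=> y; have [n] := ubnP (depth y); elim: n y => // n IH y dy yS.
have [->|yx] := eqVneq y x; first exact: branch_root.
have yr : y != r by apply: contraNneq rS => <-.
have /branch_ext : p y \in @branch parent_graph x (p x).
  by apply: IH; [apply: leq_trans (depth_parent yr) dy|rewrite clS].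
apply; rewrite del_edgeE; apply/andP; split; first by apply/parent_edgeP; right.
apply/eqP=> e; have := set22 (p y) y; rewrite e => /set2P[eyx|ey].
  by rewrite eyx eqxx in yx.
by rewrite -ey yS in pxS.
Qed.

End ParentGraph.

(** * Laminar families of hierarchies *)

Section HierarchyFamily.
Variable V : finType.
Implicit Types (A B X : {set V}) (P : {set V} -> Prop) (F : {set {set V}}).

(** The nodes of a hierarchy are identified with their sets, so that they form a finite type that
    can carry a graph. Laminarity then recovers the tree order from inclusion. *)
Record hierarchy_family P X F : Prop := HierarchyFamily {
  family_top : X \in F;
  family_sub A : A \in F -> A \subset X;
  family_neq0 A : A \in F -> A != set0;
  family_prop A : A \in F -> P A;
  family_laminar A B : A \in F -> B \in F ->
    [|| A \subset B, B \subset A | [disjoint A & B]];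
  family_split A : A \in F -> (exists v, A = [set v]) \/
    exists B C, [/\ B \in F, C \in F, [disjoint B & C] & A = B :|: C];
  family_set1 v : v \in X -> [set v] \in F }.

Lemma hierarchy_has_family P X :
  hierarchy P X -> exists F, hierarchy_family P X F.
Proof.
elim=> [v Pv|A B hA [FA fA] hB [FB fB] dAB PAB].
  exists [set [set v]]; split=> [|A|A|A|A B|A|w].
  - by rewrite inE.
  - by rewrite inE => /eqP->.
  - by rewrite inE => /eqP->; apply/set0Pn; exists v; rewrite inE.
  - by rewrite inE => /eqP->.
  - by rewrite !inE => /eqP-> /eqP->; rewrite subxx.
  - by rewrite inE => /eqP->; left; exists v.
  - by rewrite !inE => /eqP->.
exists ((A :|: B) |: (FA :|: FB)).
have sub C : C \in (A :|: B) |: (FA :|: FB) -> C \subset A :|: B.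
  case/setU1P=> [->|/setUP[/(family_sub fA)|/(family_sub fB)]] // sC.
    exact: subset_trans sC (subsetUl _ _).
  exact: subset_trans sC (subsetUr _ _).
have dF C D : C \in FA -> D \in FB -> [disjoint C & D].
  move=> /(family_sub fA) CA /(family_sub fB) DB.
  exact: disjointWl CA (disjointWr DB dAB).
split=> // [|C|C|C D|C|w].
- by rewrite !inE eqxx.
- case/setU1P=> [->|/setUP[/(family_neq0 fA)|/(family_neq0 fB)]] //.
  have /set0Pn[x xA] := hierarchy_neq0 hA.
  by apply/set0Pn; exists x; rewrite inE xA.
- by case/setU1P=> [->|/setUP[/(family_prop fA)|/(family_prop fB)]].
- move=> CF DF; move: (CF) (DF).
  case/setU1P=> [->|CF']; first by rewrite (sub _ DF) orbT.
  case/setU1P=> [->|DF']; first by rewrite (sub _ CF).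
  case/setUP: CF' => CF'; case/setUP: DF' => DF'.
  + exact: (family_laminar fA).
  + by rewrite dF ?orbT.
  + by rewrite disjoint_sym dF ?orbT.
  + exact: (family_laminar fB).
- case/setU1P=> [->|/setUP[]].
  + right; exists A, B; split=> //.
      by rewrite !inE (family_top fA) orbT.
    by rewrite !inE (family_top fB) !orbT.
  + case/(family_split fA)=> [|[C1 [C2 [h1 h2 h3 h4]]]]; first by left.
    by right; exists C1, C2; rewrite !inE h1 h2 !orbT.
  + case/(family_split fB)=> [|[C1 [C2 [h1 h2 h3 h4]]]]; first by left.
    by right; exists C1, C2; rewrite !inE h1 h2 !orbT.
- case/setUP=> [/(family_set1 fA)|/(family_set1 fB)] h; by rewrite !inE h ?orbT.
Qed.

End HierarchyFamily.

(** * From a laminar family back to a PM-decomposition *)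

Section Realization.
Variables (G : sgraph) (P : {set G} -> Prop) (v0 : G) (F : {set {set G}}).
Hypothesis famF : hierarchy_family P (~: [set v0]) F.

(* The decomposition tree, rooted at the leaf of [v0]: the node [setT] stands
   for that leaf, every other node for the shore below its parent edge. *)
Let node := {A : {set G} | A \in setT |: F}.
Implicit Types (t u w : node) (v : G).

Let top : node := Sub setT (setU11 _ _).
(** Nothing lies properly above [top], where the default [top] is returned; the tree edges come from
    the other nodes only. *)
Let parent t : node :=
  [arg min_(u < top | val t \proper val u) #|val u|].

Lemma node_val t : t != top -> val t \in F.
Proof. by rewrite -val_eqE; have /setU1P[->|] := valP t; rewrite ?eqxx. Qed.

Lemma nodeP (A : {set G}) : A \in F -> exists2 t, t != top & val t = A.
Proof.
move=> AF; have AF' : A \in setT |: F by rewrite inE AF orbT.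
exists (Sub A AF'); rewrite ?SubK // -val_eqE SubK.
apply: contraTneq (family_sub famF AF) => ->; apply/negP=> /subsetP/(_ v0).
by rewrite !inE eqxx => /(_ isT).
Qed.

Lemma node_neq0 t : val t != set0.
Proof.
have [->|/node_val] := eqVneq t top; last exact: (family_neq0 famF).
by apply/set0Pn; exists v0; rewrite inE.
Qed.

Lemma node_v0 t : (v0 \in val t) = (t == top).
Proof.
have [->|/node_val tF] := eqVneq t top; first by rewrite inE.
apply/negP=> v0t; have := subsetP (family_sub famF tF) _ v0t.
by rewrite !inE eqxx.
Qed.

Lemma node_laminar t u :
  [|| val t \subset val u, val u \subset val t | [disjoint val t & val u]].
Proof.
have [->|/node_val tF] := eqVneq t top; first by rewrite subsetT orbT.
have [->|/node_val uF] := eqVneq u top; first by rewrite subsetT.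
exact: (family_laminar famF).
Qed.

Lemma node_proper t u :
  (val t \proper val u) = (t != u) && (val t \subset val u).
Proof. by rewrite properEneq. Qed.

(** By laminarity the nodes containing the nonempty set [val t] form a chain, so a proper superset
    of least size is also least for inclusion. *)
Lemma parentP t : t != top ->
  val t \proper val (parent t) /\
  forall u, val t \proper val u -> val (parent t) \subset val u.
Proof.
move=> tt; rewrite /parent; case: arg_minnP => [|w tw minw].
  by rewrite node_proper tt subsetT.
split=> // u tu; have /or3P[//|uw|dwu] := node_laminar w u.
  apply: contraT => nwu; have := minw _ tu; rewrite leqNgt => /negP[].
  by apply: proper_card; rewrite properE uw nwu.
have /set0Pn[x xt] := node_neq0 t.
have := disjoint_notin dwu (subsetP (proper_sub tw) _ xt).
by rewrite (subsetP (proper_sub tu) _ xt).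
Qed.

Lemma parent_proper t : t != top -> val t \proper val (parent t).
Proof. by case/parentP. Qed.

Lemma parent_sub t u :
  t != top -> val t \proper val u -> val (parent t) \subset val u.
Proof. by case/parentP=> _; apply. Qed.

(** The size of the complement serves as depth, as sets grow towards the root. *)
Lemma depth_node t : t != top -> #|~: val (parent t)| < #|~: val t|.
Proof. by move/parent_proper; rewrite -properC => /proper_card. Qed.

Let tree : sgraph := parent_graph depth_node.

Lemma treeP t u : reflect
  (t != top /\ parent t = u \/ u != top /\ parent u = t) (sedge (s := tree) t u).
Proof. exact: parent_edgeP. Qed.

Lemma tree_branch t : t != top ->
  @branch tree t (parent t) = [set u : node | val u \subset val t].
Proof.
move=> tt; apply: parent_graph_branch => //.
- by rewrite inE.
- rewrite inE; apply: contra tt => /subsetP/(_ v0); rewrite inE => /(_ isT).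
  by rewrite node_v0.
- by rewrite inE; have := parent_proper tt; rewrite properE => /andP[].
move=> u ut utt; rewrite !inE; apply/idP/idP=> h.
  exact: subset_trans (proper_sub (parent_proper ut)) h.
by apply: parent_sub => //; rewrite node_proper utt.
Qed.

Lemma parent_top t : t != top -> val t = ~: [set v0] -> parent t = top.
Proof.
move=> tt et; apply/eqP; rewrite -node_v0; have /properP[_ [x xp]] := parent_proper tt.
by rewrite et !inE negbK => /eqP <-.
Qed.

Lemma degree_eq t (S : {set node}) :
  (forall u, sedge (s := tree) t u = (u \in S)) -> degree (t : tree) = #|S|.
Proof. by move=> h; apply: eq_card => u; rewrite inE h. Qed.

Lemma degree_top : degree (top : tree) = 1.
Proof.
have [x0 xt ex] := nodeP (family_top famF).
rewrite -(cards1 x0); apply: degree_eq => t; rewrite inE.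
apply/treeP/eqP=> [[[]|[tt et]]|->]; first by rewrite eqxx.
  apply/eqP; apply: contraT => tx.
  have : val (parent t) \subset val x0.
    apply: parent_sub => //; rewrite node_proper tx ex.
    exact: (family_sub famF (node_val tt)).
  move/subsetP/(_ v0); rewrite et inE => /(_ isT).
  by rewrite node_v0 (negPf xt).
by right; split=> //; apply: parent_top.
Qed.

Lemma degree_set1 t v : t != top -> val t = [set v] -> degree (t : tree) = 1.
Proof.
move=> tt et; rewrite -(cards1 (parent t)); apply: degree_eq => u.
rewrite inE; apply/treeP/eqP=> [[[]//|[ut eu]]|->]; last by left.
have := parent_proper ut; rewrite eu et => /proper_card; rewrite cards1.
by rewrite ltnS leqn0 cards_eq0 (negPf (node_neq0 u)).
Qed.

Lemma node_sub_disjoint t u :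
  val t \subset val u -> [disjoint val t & val u] -> False.
Proof.
move=> tu dtu; have /set0Pn[x xt] := node_neq0 t.
by have := disjoint_notin dtu xt; rewrite (subsetP tu _ xt).
Qed.

(** The parent of [u] lies within [t] and is comparable with or disjoint from [w]. It cannot lie
    inside [w], and disjointness would squeeze it into [u]; so it contains [w] and equals [t]. *)
Lemma parent_split t u w : u != top -> [disjoint val u & val w] ->
  val t = val u :|: val w -> parent u = t.
Proof.
move=> ut duw et; apply/val_inj/eqP; rewrite eqEsubset.
have upu := parent_proper ut.
have ut' : val u \proper val t.
  rewrite properE et subsetUl; apply/negP=> /(subset_trans (subsetUr _ _)) wu.
  by apply: (node_sub_disjoint wu); rewrite disjoint_sym.
rewrite parent_sub //= et subUset (proper_sub upu) /=.
have /or3P[puw|//|dpw] := node_laminar (parent u) w.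
  by case: (node_sub_disjoint (subset_trans (proper_sub upu) puw) duw).
move: upu; rewrite properE => /andP[_ /negP[]]; apply/subsetP=> x xp.
have := subsetP (parent_sub ut ut') _ xp; rewrite et => /setUP[//|xw].
by have := disjoint_notin dpw xp; rewrite xw.
Qed.

Lemma degree_split t u w : t != top -> u != top -> w != top ->
  [disjoint val u & val w] -> val t = val u :|: val w -> degree (t : tree) = 3.
Proof.
move=> tt ut wt duw et.
have pu : parent u = t by apply: parent_split et.
have pw : parent w = t.
  by apply: (@parent_split _ _ u); rewrite // 1?disjoint_sym // et setUC.
have neq x : x != top -> parent x = t -> parent t != x.
  move=> xt ex; apply/eqP=> ex'; have := proper_trans (parent_proper xt) (parent_proper _).
  by rewrite ex ex' => /(_ tt); rewrite properxx.
have uw : u != w.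
  apply/eqP=> euw; apply: (@node_sub_disjoint u u) => //.
  by move: duw; rewrite -euw.
have -> : 3 = #|parent t |: [set u; w]|.
  by rewrite cardsU1 cards2 uw !inE negb_or !neq.
apply: degree_eq => x; rewrite !inE.
apply/treeP/or3P=> [[[_ ->]|[xt ex]]|]; last first.
- case=> /eqP->; [by left|by right|by right].
(* Comparable children of [t] coincide, for a child properly inside another would have its parent
   [t] inside that one too. A child incomparable with [u] is disjoint from it, hence contained in
   [w]. *)
- have sub y : y != top -> parent y = t -> val x \subset val y -> x = y.
    move=> yt ey xy; apply/eqP; apply: contraT => nxy.
    have := parent_proper yt; rewrite ey -ex properE => /andP[_ /negP[]].
    by apply: parent_sub => //; rewrite node_proper nxy.
  have sup y : y != top -> parent y = t -> val y \subset val x -> x = y.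
    move=> yt ey yx; apply/eqP; apply: contraT => nxy.
    have := parent_proper xt; rewrite ex -ey properE => /andP[_ /negP[]].
    by apply: parent_sub => //; rewrite node_proper eq_sym nxy.
  have /or3P[xu|ux|dxu] := node_laminar x u.
  + by constructor 2; apply/eqP/sub.
  + by constructor 2; apply/eqP/sup.
  constructor 3; apply/eqP/sub => //; apply/subsetP=> z zx.
  have := subsetP (proper_sub (parent_proper xt)) _ zx.
  rewrite ex et => /setUP[zu|//].
  by have := disjoint_notin dxu zx; rewrite zu.
- by constructor 1.
Qed.

Lemma node_cases t : t = top \/ t != top /\ (exists v, val t = [set v]) \/
  t != top /\ degree (t : tree) = 3.
Proof.
have [->|tt] := eqVneq t top; [by left|right].
case: (family_split famF (node_val tt)) => [|[B [C [BF CF dBC eA]]]].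
  by left.
right; split=> //; have [[u ut eu] [w wt ew]] := (nodeP BF, nodeP CF).
by apply: (degree_split tt ut wt); rewrite eu ew.
Qed.

Lemma tree_cubic : cubic_tree tree.
Proof.
split; first by split; [apply: parent_graph_connected|apply: parent_graph_acyclic].
move=> t; rewrite /leaf; case: (node_cases t) => [->|[[tt [v ev]]|[]//]].
  by rewrite degree_top.
by rewrite (degree_set1 tt ev).
Qed.

(* [[set v0]] is not a node, hence [insubd] sends [v0] to the root [top]. *)
Let leaf_of v : node := insubd top [set v].

Lemma leaf_ofE v : v != v0 -> leaf_of v != top /\ val (leaf_of v) = [set v].
Proof.
move=> vv0; have vF : [set v] \in F by apply: (family_set1 famF); rewrite !inE.
have [t tt et] := nodeP vF.
suff -> : leaf_of v = t by [].
by apply: val_inj; rewrite val_insubd -et (valP t).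
Qed.

Lemma leaf_of_v0 : leaf_of v0 = top.
Proof.
apply/eqP; rewrite -node_v0 val_insubd; case: ifP => // _; by rewrite !inE.
Qed.

Lemma leaf_of_leaf v : leaf (leaf_of v : tree).
Proof.
rewrite /leaf; have [->|/leaf_ofE[tt ev]] := eqVneq v v0.
  by rewrite leaf_of_v0 degree_top.
by rewrite (degree_set1 tt ev).
Qed.

Lemma leaf_of_inj : injective leaf_of.
Proof.
move=> v w; have [->|/leaf_ofE[vt ev]] := eqVneq v v0; last first.
  have [->|/leaf_ofE[wt ew] e] := eqVneq w v0.
    by rewrite leaf_of_v0 => e; rewrite e eqxx in vt.
  by apply: set1_inj; rewrite -ev -ew e.
have [->//|/leaf_ofE[wt _] e] := eqVneq w v0.
by rewrite -e leaf_of_v0 eqxx in wt.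
Qed.

Lemma leaf_of_surj t : leaf (t : tree) -> exists v, leaf_of v = t.
Proof.
rewrite /leaf; case: (node_cases t) => [->|[[tt [v ev]] _|[_ ->]//]].
  by exists v0; apply: leaf_of_v0.
exists v; have vv0 : v != v0.
  by apply: contra tt => /eqP e; rewrite -node_v0 ev -e inE.
by apply: val_inj; have [_ ->] := leaf_ofE vv0.
Qed.

Let delta_of (l : {t : tree | leaf t}) : G :=
  odflt v0 [pick v | leaf_of v == val l].
Let leafG v : {t : tree | leaf t} := Sub (leaf_of v : tree) (leaf_of_leaf v).

Lemma leafGK : cancel leafG delta_of.
Proof.
move=> v; rewrite /delta_of; case: pickP => [w /eqP/leaf_of_inj //|/(_ v)].
by rewrite SubK eqxx.
Qed.

Lemma delta_ofK : cancel delta_of leafG.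
Proof.
move=> l; have [v ev] := leaf_of_surj (valP l); apply: val_inj.
by have -> : l = leafG v; [apply: val_inj|rewrite leafGK].
Qed.

Let D : pm_decomposition G :=
  PMDecomposition tree_cubic (Bijective delta_ofK leafGK).

Lemma realization_shore t : t != top -> @shore G D t (parent t) = val t.
Proof.
move=> tt; apply/setP=> v; rewrite -{1}(leafGK v).
rewrite (@mem_shore _ D t (parent t) (leafG v)) SubK [branch _ _]tree_branch // inE.
have [->|/leaf_ofE[_ ->]] := eqVneq v v0; last by rewrite sub1set.
rewrite leaf_of_v0 node_v0 subTset (negPf tt); apply/eqP=> e.
by case/eqP: tt; apply: val_inj.
Qed.

(** Every tree edge joins a node to its parent, and only the shore on the child's side is known to
    be in the family; hence the disjunction. *)
Lemma family_realization : exists D : pm_decomposition G,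
  forall t1 t2 : dtree D, t1 -- t2 -> P (shore t1 t2) \/ P (shore t2 t1).
Proof.
exists D => t1 t2 /treeP[[tt <-]|[tt <-]]; [left|right];
  by rewrite realization_shore //; apply: (family_prop famF); apply: node_val.
Qed.

End Realization.

(** * Parity of spine cuts and of the width *)

Section NoOddEdges.
Variable G : sgraph.

(** An odd tame shore has a single vertex on one side, which makes an end of the edge a leaf. So
    spine shores are even, and so are their complements as the order is even. *)
Lemma no_odd_edges (D : pm_decomposition G) (k : nat) :
  ~~ odd #|G| ->
  (forall t1 t2 : dtree D, t1 -- t2 ->
     tame_shore k (shore t1 t2) \/ tame_shore k (shore t2 t1)) ->
  forall t1 t2 : dtree D, ~~ odd_edge t1 t2.
Proof.
move=> eG hD; have main (t1 t2 : dtree D) :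
    spine_edge t1 t2 -> tame_shore k (shore t1 t2) -> even_edge t1 t2.
  case/and3P=> t12 l1 l2 [_]; rewrite -shoreC // => h.
  have o1 : ~~ odd #|shore t1 t2|.
    apply/negP=> /h[/(leaf_shore1 t12)|]; first exact/negP.
    by move/leaf_shore1; rewrite sedge_sym (negPf l2) => /(_ t12).
  rewrite /even_edge -!card_shore o1 shoreC //=.
  by move: eG; rewrite -(cardsC (shore t1 t2)) oddD (negPf o1).
move=> t1 t2; rewrite /odd_edge; apply/negP=> /andP[sp /negP[]].
have t12 : t1 -- t2 by case/and3P: sp.
case: (hD _ _ t12); first exact: main.
rewrite /even_edge andbC; apply: main.
by case/and3P: sp => *; apply/and3P; split; rewrite // sedge_sym.
Qed.

(** The porosity is attained by a perfect matching, whose share of the cut has the parity of [A];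
    with no perfect matching it is 0. *)
Lemma mp_cut_odd (A : {set G}) : odd (mp (cut A)) -> odd #|A|.
Proof.
rewrite /mp; have [M0 pM0|noM] := pickP (@perfect_matching G); last first.
  by rewrite big_pred0.
have [|M pM ->] := @eq_bigmax_cond _ (@perfect_matching G) (fun M => #|M :&: cut A|).
  by apply/card_gt0P; exists M0.
by rewrite odd_card_matching_cut.
Qed.

Lemma mp_shore_leaf (D : pm_decomposition G) (t1 t2 : dtree D) :
  t1 -- t2 -> leaf t1 || leaf t2 -> mp (cut (shore t1 t2)) <= 1.
Proof.
move=> t12 /orP[l1|l2].
  by have [v ->] := shore_leafl l1 t12; apply: mp_cut1.
rewrite sedge_sym in t12; have [v ev] := shore_leafl l2 t12.
by rewrite (shoreC t12) cutC ev mp_cut1.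
Qed.

Lemma spine_shore_even (D : pm_decomposition G) (t1 t2 : dtree D) :
  ~~ odd_edge t1 t2 -> spine_edge t1 t2 -> ~~ odd (mp (cut (shore t1 t2))).
Proof.
rewrite /odd_edge => no sp; rewrite sp negbK in no.
by apply: (contra (@mp_cut_odd _)); rewrite card_shore; case/andP: no.
Qed.

(** The neighbour [t] of a leaf sees at least three vertices on its own side. So it is an inner
    node, and its two other neighbours cannot both be leaves. *)
Lemma exists_spine_edge (D : pm_decomposition G) :
  3 < #|G| -> exists t1 t2 : dtree D, spine_edge t1 t2.
Proof.
move=> G3; have /card_gt0P[v _] : 0 < #|G| by apply: leq_trans G3.
have [l _] := delta_surj D v; have [t lt] := leaf_has_neighbour l.
have tl : t -- val l by rewrite sedge_sym.
have St : 2 < #|shore t (val l)|.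
  rewrite (shoreC lt) shore_leaf // cardsCs setCK cards1.
  by move: G3; case: #|G| => // n; rewrite subn1.
have nlt : ~~ leaf t.
  apply/negP=> /shore_leafl/(_ tl)[w ew]; by rewrite ew cards1 in St.
have [a [b [[ta tb eS] dS _ _]]] := shore_split tl nlt.
have [la|la] := boolP (leaf a); last by exists a, t; apply/and3P.
have [lb|lb] := boolP (leaf b); last by exists b, t; apply/and3P.
have [[x ex] [y ey]] := (shore_leafl la ta, shore_leafl lb tb).
by rewrite eS ex ey in St; have := leq_trans St (leq_card_setU _ _); rewrite !cards1.
Qed.

(** A spine cut has even positive porosity, so the width is at least 2. An edge of maximal porosity
    is thus not at a leaf, where porosity is at most 1, and lies in the spine. *)
Lemma no_odd_edges_width (D : pm_decomposition G) :
  matching_covered G -> 3 < #|G| -> (forall t1 t2 : dtree D, ~~ odd_edge t1 t2) ->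
  ~~ odd (width D).
Proof.
move=> mG G3 noD; have [s1 [s2 sp]] := exists_spine_edge D G3.
have s12 : s1 -- s2 by case/and3P: sp.
have w2 : 1 < width D.
  apply: leq_trans (mp_shore_le_width s12).
  have : 0 < mp (cut (shore s1 s2)).
    apply: mp_cut_gt0 => //; first exact: shore_neq0.
    have : shore s2 s1 != set0 by rewrite shore_neq0 // sedge_sym.
    by rewrite shoreC // -setCT (inj_eq (@setC_inj _)).
  by have := spine_shore_even (noD _ _) sp; case: mp => [|[]].
apply: contraL w2 => ow; rewrite -leqNgt.
have [|[t1 t2] /= t12 ew] := @eq_bigmax_cond _
  (fun p : dtree D * dtree D => p.1 -- p.2) (fun p => mp (cut (shore p.1 p.2))).
  by apply/card_gt0P; exists (s1, s2).
rewrite /width ew in ow *; have [lf|] := boolP (leaf t1 || leaf t2).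
  exact: mp_shore_leaf.
rewrite negb_or => /andP[l1 l2].
have sp' : spine_edge t1 t2 by apply/and3P.
by rewrite (negPf (spine_shore_even (noD _ _) sp')) in ow.
Qed.

End NoOddEdges.

(** Order two has to be excluded: the only cubic tree with two leaves is a single edge, so the
    single edge graph has [k = 1] and no decomposition of width 2. *)
Theorem theorem1 (G : sgraph) (k : nat) :
  matching_covered G ->
  #|G| <> 2 ->
  has_pmw G k ->
  exists D : pm_decomposition G,
    width D = k + k %% 2 /\
    forall t1 t2 : dtree D, ~~ odd_edge t1 t2.
Proof.
move=> mG G2 [[D0 <-] minD]; have [[G0 _] _] := mG; case/card_gt0P: G0 => v _.
have hP := decomposition_hierarchy D0 v.
have Xn0 := hierarchy_neq0 hP.
have G1 : 1 < #|G| by rewrite -(cardsC [set v]) cards1 add1n ltnS card_gt0.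
have [M pM] := exists_perfect_matching mG G1; have eG := even_order pM.
(* Order two is excluded by hypothesis and order three by parity. *)
have G3 : 3 < #|G| by move: G1 G2 eG; case: #|G| => [|[|[|[|n]]]].
have k0 : 0 < width D0.
  apply: leq_trans (hierarchy_top hP); apply: mp_cut_gt0 => //.
  by apply/eqP=> /setP/(_ v); rewrite !inE eqxx.
have [F famF] := hierarchy_has_family (rearrange_coatom k0 eG hP).
have [D hD] := family_realization famF; exists D.
have noD := no_odd_edges eG hD; split=> //.
have eD := no_odd_edges_width mG G3 noD.
have leD : width D <= width D0 + width D0 %% 2.
  apply/bigmax_leqP=> -[t1 t2] /= t12.
  by case: (hD _ _ t12) => -[]; rewrite // (shoreC t12) cutC.
apply/eqP; rewrite eqn_leq leD; move: eD (minD D); rewrite modn2.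
(* For even [k] minimality alone gives the lower bound; for odd [k] the width of [D] is even, so it
   differs from [k] and is at least [k + 1]. *)
case o0: (odd (width D0)); rewrite ?addn0 // addn1 => eD.
by rewrite leq_eqVlt => /orP[/eqP e|//]; rewrite -e o0 in eD.
Qed.
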